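(* Let $N\ge1$ and consider the $1$-parameter family $\mathcal{X}_t:=\{f_t(\mathbf{x})=0\}$, $t\in\mathbb{C}$, with $$f_0(\mathbf{x}):=\sum_{i=1}^{N-1}x_i^2+x_N^3+x_Nx_{N+1}^3,\qquad f_t(\mathbf{x}):=f_0(\mathbf{x})-3t^2x_Nx_{N+1}^2-2t^3x_{N+1}^3+t\,x_{N+1}^4 .$$ Then, for generic $t\in\mathbb{C}$, $\mathcal{X}_t$ admits the unique singular point $\mathbf{0}\in f_t^{-1}(0)$, which is of type $D_6$.
   Context: $\mathbf{x}=(x_1,\ldots,x_{N+1})\in\mathbb{C}^{N+1}$. An isolated hypersurface singularity is of type $D_m$ ($m\ge4$) if it is equivalent, up to a local biholomorphic change of coordinates, to $\sum_{i=1}^{N-1}x_i^2+x_N^2x_{N+1}+x_{N+1}^{m-1}=0$ at the origin. *)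

(* Defs.v *)
From HB Require Import structures.
From mathcomp Require Import all_boot all_order all_algebra.
From mathcomp Require Import all_classical all_reals all_analysis.

Set Implicit Arguments.
Unset Strict Implicit.
Unset Printing Implicit Defensive.

Import Order.TTheory GRing.Theory Num.Theory numFieldNormedType.Exports.

Local Open Scope classical_set_scope.
Local Open Scope ring_scope.

(* The definitions are over an arbitrary numClosedFieldType C, and meant for the
   complex numbers R[i] with R : realType.  C^n is 'rV[C]_n with its sup-norm
   topology, and [differentiable] is Frechet differentiability with a C-linear
   differential, so over R[i] being differentiable at every point of an open
   set means being holomorphic there. *)

Definition holomorphic_on (C : numClosedFieldType) (V W : normedModType C)
    (U : set V) (F : V -> W) : Prop :=
  forall z, U z -> differentiable F z.

Definition biholomorphism (C : numClosedFieldType) (n : nat)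
    (U V : set 'rV[C]_n) (phi psi : 'rV[C]_n -> 'rV[C]_n) : Prop :=
  [/\ open U /\ open V,
      holomorphic_on U phi /\ holomorphic_on V psi,
      (forall z, U z -> V (phi z)) /\ (forall w, V w -> U (psi w)),
      forall z, U z -> psi (phi z) = z
    & forall w, V w -> phi (psi w) = w].

Definition local_biholomorphism (C : numClosedFieldType) (n : nat)
    (phi : 'rV[C]_n -> 'rV[C]_n) (p q : 'rV[C]_n) : Prop :=
  phi p = q /\
  exists U V psi, [/\ U p, V q & biholomorphism U V phi psi].

(* The germ at p of the hypersurface f = 0 is carried to the germ at q of
   g = 0 by a local biholomorphic change of coordinates: the pulled-back
   equation of the first generates the same ideal as the equation of the
   second, that is, they agree up to a nowhere vanishing holomorphic factor. *)
Definition hypersurface_germ_equiv (C : numClosedFieldType) (n : nat)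
    (f : 'rV[C]_n -> C) (p : 'rV[C]_n)
    (g : 'rV[C]_n -> C) (q : 'rV[C]_n) : Prop :=
  exists (phi : 'rV[C]_n -> 'rV[C]_n) (u : 'rV[C]_n -> C),
    local_biholomorphism phi q p /\
    \forall z \near q,
      [/\ differentiable u z, u z != 0 & f (phi z) = u z * g z].

(* Meant for differentiable f, as 'D_v f x is meaningless otherwise. *)
Definition singular_point (C : numClosedFieldType) (n : nat)
    (f : 'rV[C]_n -> C) (x : 'rV[C]_n) : Prop :=
  f x = 0 /\ forall i : 'I_n, 'D_(delta_mx 0 i) f x = 0.

Definition isolated_singular_point (C : numClosedFieldType) (n : nat)
    (f : 'rV[C]_n -> C) (p : 'rV[C]_n) : Prop :=
  singular_point f p /\ \forall x \near p, singular_point f x -> x = p.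

(* Coordinates of C^(N+1), N >= 1, are numbered from 0: the coordinates
   x_1, ..., x_(N-1), x_N, x_(N+1) have indices 0, ..., N-2, N-1, N. *)

Definition sum_squares (C : numClosedFieldType) (N : nat) (x : 'rV[C]_N.+1) : C :=
  \sum_(i < N.+1 | (i < N.-1)%N) x 0 i ^+ 2.

Definition x_N (C : numClosedFieldType) (N : nat) (x : 'rV[C]_N.+1) : C :=
  x 0 (inord N.-1).

Definition x_N1 (C : numClosedFieldType) (N : nat) (x : 'rV[C]_N.+1) : C :=
  x 0 ord_max.

Definition D_normal_form (C : numClosedFieldType) (N m : nat)
    (x : 'rV[C]_N.+1) : C :=
  sum_squares x + x_N x ^+ 2 * x_N1 x + x_N1 x ^+ m.-1.

Definition singularity_of_type_D (C : numClosedFieldType) (N m : nat)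
    (f : 'rV[C]_N.+1 -> C) (p : 'rV[C]_N.+1) : Prop :=
  [/\ (4 <= m)%N,
      isolated_singular_point f p
    & hypersurface_germ_equiv f p (@D_normal_form C N m) 0].

Definition f0 (C : numClosedFieldType) (N : nat) (x : 'rV[C]_N.+1) : C :=
  sum_squares x + x_N x ^+ 3 + x_N x * x_N1 x ^+ 3.

Definition ft (C : numClosedFieldType) (N : nat) (t : C) (x : 'rV[C]_N.+1) : C :=
  f0 x - 3%:R * t ^+ 2 * x_N x * x_N1 x ^+ 2
       - 2%:R * t ^+ 3 * x_N1 x ^+ 3 + t * x_N1 x ^+ 4.

(* P holds on a nonempty Zariski open subset of the affine line C. *)
Definition for_generic (C : numClosedFieldType) (P : C -> Prop) : Prop :=
  exists2 p : {poly C}, p != 0 & forall t, p.[t] != 0 -> P t.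

(* Main.v *)
Require Import Defs.
From HB Require Import structures.
From mathcomp Require Import all_boot all_order all_algebra complex ring.
From mathcomp Require Import all_classical all_reals all_analysis.

Set Implicit Arguments.
Unset Strict Implicit.
Unset Printing Implicit Defensive.

Import Order.TTheory GRing.Theory Num.Theory numFieldNormedType.Exports.

Local Open Scope classical_set_scope.
Local Open Scope complex_scope.
Local Open Scope ring_scope.

(** In the plane of the last two coordinates a = x_N and b = x_N1, put
    w = a + t * b.  The non-quadratic part of the equation is then
      w * (w ^ 2 - 3 * t * w * b + b ^ 3),
    a line together with a nodal cubic.  For t <> 0 its germ at the origin has
    three smooth branches: the line, the branch of the node that is tangent to
    the line, and the transversal branch of the node.  This is exactly the
    configuration of the three branches of x ^ 2 * y + y ^ 5, which is D_6.

    The change of coordinates is explicit up to square roots.  The node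
    is parametrised by b = tau ^ 2 * s * (1 - s),
    w = tau ^ 3 * s ^ 2 * (1 - s), with tau = 3 * t.  Taking s as a coordinate
    instead of b, and sigma with
    w = tau ^ 3 * sigma * (1 - sigma) * (1 - s) instead of w
    ([branch_chart]), the equation factors as
      - tau ^ 9 * (1 - s) ^ 3 * (1 - sigma) * (1 - sigma - s)
        * sigma * (s - sigma) * (sigma * (1 - sigma) - s ^ 2).
    With y = s - sigma and p = sigma * (1 - 2 * s) one has
    sigma * (1 - sigma) - s ^ 2 = p - y ^ 2, so that the three branches are
    p = 0, p = y ^ 2 and y = 0, and X = 2 * i * (p - y ^ 2 / 2) satisfies
    X ^ 2 * y + y ^ 5 = - 4 * y * p * (p - y ^ 2) ([normal_chart]).  The unit
    left over is absorbed in the remaining coordinates by multiplying them by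
    one of its square roots ([ft_charts]).  The local inverses of both charts
    only require inverting z * (1 - z) at the origin, hence a square root
    holomorphic near 1.

    The singular points are found by elimination
    ([plane_critical_point]); the excluded parameter is t = 0, where the
    node degenerates to a cusp. *)

(** * Germs of holomorphic maps *)

Definition holomorphic_near (C : numClosedFieldType) (V W : normedModType C)
    (f : V -> W) (p : V) : Prop :=
  \forall z \near p, differentiable f z.

Lemma holomorphic_near_continuous (C : numClosedFieldType)
    (V W : normedModType C) (f : V -> W) (p : V) :
  holomorphic_near f p -> {for p, continuous f}.
Proof. by move=> /nbhs_singleton; apply: differentiable_continuous. Qed.

Lemma near_preimage (C : numClosedFieldType) (V W : normedModType C)
    (f : V -> W) (p : V) (P : W -> Prop) :
  holomorphic_near f p -> (\forall w \near f p, P w) ->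
  \forall z \near p, P (f z).
Proof. by move=> /holomorphic_near_continuous fp; apply: fp. Qed.

Lemma near_neq0 (C : numClosedFieldType) (V : normedModType C)
    (f : V -> C) (p : V) :
  holomorphic_near f p -> f p != 0 -> \forall z \near p, f z != 0.
Proof.
by move=> /holomorphic_near_continuous fp; apply: cvgr_neq0 fp.
Qed.

Lemma holomorphic_near_cst (C : numClosedFieldType) (V W : normedModType C)
    (p : V) (a : W) :
  holomorphic_near (fun=> a) p.
Proof. by apply: nearW => z; apply: differentiable_cst. Qed.

Lemma holomorphic_nearD (C : numClosedFieldType) (V W : normedModType C)
    (p : V) (f g : V -> W) :
  holomorphic_near f p -> holomorphic_near g p ->
  holomorphic_near (fun z => f z + g z) p.
Proof. by apply: filterS2 => z; apply: differentiableD. Qed.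

Lemma holomorphic_nearN (C : numClosedFieldType) (V W : normedModType C)
    (p : V) (f : V -> W) :
  holomorphic_near f p -> holomorphic_near (fun z => - f z) p.
Proof. by apply: filterS => z; apply: differentiableN. Qed.

Lemma holomorphic_nearM (C : numClosedFieldType) (V : normedModType C)
    (p : V) (f g : V -> C) :
  holomorphic_near f p -> holomorphic_near g p ->
  holomorphic_near (fun z => f z * g z) p.
Proof. by apply: filterS2 => z; apply: differentiableM. Qed.

Lemma holomorphic_nearX (C : numClosedFieldType) (V : normedModType C)
    (p : V) (f : V -> C) (n : nat) :
  holomorphic_near f p -> holomorphic_near (fun z => f z ^+ n) p.
Proof.
move=> hf; elim: n => [|n IHn]; first exact: holomorphic_near_cst.
under [X in holomorphic_near X]eq_fun do rewrite exprS.
exact: holomorphic_nearM.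
Qed.

Lemma holomorphic_nearV (C : numClosedFieldType) (V : normedModType C)
    (p : V) (f : V -> C) :
  holomorphic_near f p -> f p != 0 -> holomorphic_near (fun z => (f z)^-1) p.
Proof.
move=> hf fp; move: (near_neq0 hf fp) (hf).
apply: filterS2 => z fz df; apply: (differentiable_comp df).
exact: differentiable_Rinv.
Qed.

Lemma holomorphic_near_comp (C : numClosedFieldType) (U V W : normedModType C)
    (p : U) (f : U -> V) (g : V -> W) :
  holomorphic_near f p -> holomorphic_near g (f p) ->
  holomorphic_near (g \o f) p.
Proof.
move=> hf hg; move: (near_preimage hf hg) (hf).
by apply: filterS2 => z dg df; apply: differentiable_comp.
Qed.

Lemma holomorphic_near_coord (C : numClosedFieldType) (n : nat)
    (p : 'rV[C]_n) (i : 'I_n) :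
  holomorphic_near (fun z : 'rV[C]_n => z 0 i) p.
Proof. by apply: (@filterE _ (nbhs p)) => z; apply: differentiable_coord. Qed.

Lemma holomorphic_near_row (C : numClosedFieldType) (V : normedModType C)
    (n : nat) (p : V) (f : V -> 'rV[C]_n) :
  (forall i, holomorphic_near (fun z => f z 0 i) p) -> holomorphic_near f p.
Proof.
move=> hf.
have : \forall z \near p, forall i, differentiable (fun z => f z 0 i) z.
  by apply: filter_forall => i; apply: hf.
apply: filterS => z dz.
rewrite (_ : f = \sum_i (fun z => f z 0 i *: delta_mx 0 i)); last first.
  apply/funext => x; rewrite [LHS]row_sum_delta fct_sumE.
  by apply: eq_bigr.
by apply: differentiable_sum => i; apply: differentiableZl.
Qed.

(** Local inverses are recorded as germs, because germs compose without
    shrinking domains at each step; the open sets required by a local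
    biholomorphism are chosen once, at the end. *)
Definition inverse_germs (C : numClosedFieldType) (n : nat)
    (phi psi : 'rV[C]_n -> 'rV[C]_n) (p q : 'rV[C]_n) : Prop :=
  [/\ phi p = q /\ psi q = p,
      holomorphic_near phi p, holomorphic_near psi q,
      \forall z \near p, psi (phi z) = z
    & \forall w \near q, phi (psi w) = w].

Lemma inverse_germs_comp (C : numClosedFieldType) (n : nat)
    (phi psi phi' psi' : 'rV[C]_n -> 'rV[C]_n) (p q r : 'rV[C]_n) :
  inverse_germs phi psi p q -> inverse_germs phi' psi' q r ->
  inverse_germs (phi' \o phi) (psi \o psi') p r.
Proof.
move=> [[pq qp] hphi hpsi c1 c2] [[qr rq] hphi' hpsi' c1' c2']; split.
- by rewrite /= pq rq.
- by apply: holomorphic_near_comp; rewrite ?pq.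
- by apply: holomorphic_near_comp; rewrite ?rq.
- rewrite -pq in c1'; move: (near_preimage hphi c1') c1.
  by apply: filterS2 => z /= ->.
- rewrite -rq in c2; move: (near_preimage hpsi' c2) c2'.
  by apply: filterS2 => z /= ->.
Qed.

(** Start from open sets U0 and V0 on which the two maps are differentiable and
    cancel; the points of U0 sent into V0 and the points of V0 sent into U0
    form open sets that the two maps exchange. *)
Lemma inverse_germs_local_biholomorphism (C : numClosedFieldType) (n : nat)
    (phi psi : 'rV[C]_n -> 'rV[C]_n) (p q : 'rV[C]_n) :
  inverse_germs phi psi p q -> local_biholomorphism phi p q.
Proof.
move=> [[pq qp] hphi hpsi cphi cpsi]; split => //.
pose U0 := interior [set z | differentiable phi z /\ psi (phi z) = z].
pose V0 := interior [set w | differentiable psi w /\ phi (psi w) = w].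
have U0p : U0 p by apply: filterS2 hphi cphi.
have V0q : V0 q by apply: filterS2 hpsi cpsi.
have U0P z : U0 z -> differentiable phi z /\ psi (phi z) = z.
  exact: (@interior_subset _ [set z | differentiable phi z /\ psi (phi z) = z]).
have V0P w : V0 w -> differentiable psi w /\ phi (psi w) = w.
  exact: (@interior_subset _ [set w | differentiable psi w /\ phi (psi w) = w]).
have oU0 : open U0 by apply: open_interior.
have oV0 : open V0 by apply: open_interior.
have openP (f : 'rV[C]_n -> 'rV[C]_n) (A B : set 'rV[C]_n) :
    open A -> open B -> (forall z, A z -> differentiable f z) ->
    open (A `&` f @^-1` B).
  move=> oA oB df; rewrite openE => z [Az Bfz]; apply: filterI.
    exact: open_nbhs_nbhs.
  by apply: (differentiable_continuous (df z Az)); apply: open_nbhs_nbhs.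
exists (U0 `&` phi @^-1` V0), (V0 `&` psi @^-1` U0), psi; split.
- by split; rewrite /preimage /= ?pq.
- by split; rewrite /preimage /= ?qp.
split.
- by split; apply: openP => // z; [move=> /U0P[]|move=> /V0P[]].
- by split=> z [] => [/U0P[]|/V0P[]].
- split=> z [z0 z1]; split => //=.
    by have [_ ->] := U0P _ z0.
  by have [_ ->] := V0P _ z0.
- by move=> z [/U0P[]].
- by move=> w [/V0P[]].
Qed.

(** * A holomorphic square root near 1 *)

(** A square root of z at least as close to 1 as the other one.  The branch
    chosen by [sqrtC] cannot be used directly: it is discontinuous at 1, since it has
    a nonnegative imaginary part. *)
Definition sqrt_near1 (C : numClosedFieldType) (z : C) : C :=
  if `|sqrtC z - 1| <= `|sqrtC z + 1| then sqrtC z else - sqrtC z.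

Lemma sqrt_near1K (C : numClosedFieldType) (z : C) : sqrt_near1 z ^+ 2 = z.
Proof. by rewrite /sqrt_near1; case: ifP; rewrite ?sqrrN sqrtCK. Qed.

Lemma sqrt_near1_le (C : numClosedFieldType) (z : C) :
  `|sqrt_near1 z - 1| <= `|sqrt_near1 z + 1|.
Proof.
rewrite /sqrt_near1; case: ifPn => //.
rewrite -real_ltNge ?normr_real // => /ltW.
have -> : - sqrtC z - 1 = - (sqrtC z + 1) by ring.
have -> : - sqrtC z + 1 = - (sqrtC z - 1) by ring.
by rewrite !normrN.
Qed.

Lemma sqrt_near1_unique (C : numClosedFieldType) (s : C) :
  `|s - 1| < `|s + 1| -> sqrt_near1 (s ^+ 2) = s.
Proof.
move=> hs; have := sqrt_near1_le (s ^+ 2); have := sqrt_near1K (s ^+ 2).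
move: (sqrt_near1 _) => r /eqP; rewrite eqf_sqr => /orP[/eqP//|/eqP->].
have -> : - s - 1 = - (s + 1) by ring.
have -> : - s + 1 = - (s - 1) by ring.
by rewrite !normrN real_leNgt ?normr_real // hs.
Qed.

Lemma normD1_ge (C : numClosedFieldType) (s : C) : 2 - `|s - 1| <= `|s + 1|.
Proof.
rewrite lerBlDr.
have -> : 2 = `|(s + 1) - (s - 1)| :> C.
  by rewrite opprD opprK addrACA subrr add0r -mulr2n normr_nat.
exact: ler_normB.
Qed.

(** Since (r - 1) * (r + 1) = z - 1 for the root r of z, it suffices that the
    distance from r to - 1 is at least 1.  It is, being the larger of the
    distances from r to 1 and to - 1, whose sum is at least 2. *)
Lemma sqrt_near1_dist1 (C : numClosedFieldType) (z : C) :
  `|sqrt_near1 z - 1| <= `|z - 1|.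
Proof.
have h := sqrt_near1_le z; have h2 := normD1_ge (sqrt_near1 z).
have h1 : 1 <= `|sqrt_near1 z + 1|.
  rewrite -(@ler_pM2l _ 2) ?ltr0n // mulr1 mulr_natl mulr2n.
  by apply: le_trans (lerD (lexx _) h); rewrite -lerBlDr.
rewrite -{2}[z]sqrt_near1K -[X in _ ^+ _ - X](expr1n _ 2) subr_sqr normrM.
by rewrite ler_peMr.
Qed.

Lemma near_sqrt_near1_sqr (C : numClosedFieldType) :
  \forall s \near (1 : C), sqrt_near1 (s ^+ 2) = s.
Proof.
near=> s; apply: sqrt_near1_unique.
have s1 : `|s - 1| < 1 by near: s; apply: cvgr_distC_lt => //; apply: ltr01.
apply: (lt_le_trans s1); apply: le_trans (normD1_ge s).
by rewrite lerBrDl -[2]/(1 + 1) lerD // ltW.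
Unshelve. all: by end_near. Qed.

Lemma sqrt_near1_1 (C : numClosedFieldType) : sqrt_near1 (1 : C) = 1.
Proof. by have := nbhs_singleton (near_sqrt_near1_sqr C); rewrite expr1n. Qed.

(** Both roots r and s stay within 1/2 of 1, so r + s has norm at least 1 in
    z - w = (r - s) * (r + s). *)
Lemma sqrt_near1_lipschitz (C : numClosedFieldType) (z w : C) :
    `|z - 1| < 2^-1 -> `|w - 1| < 2^-1 ->
  `|sqrt_near1 z - sqrt_near1 w| <= `|z - w|.
Proof.
move=> hz hw; set r := sqrt_near1 z; set s := sqrt_near1 w.
have hr : `|r - 1| < 2^-1 := le_lt_trans (sqrt_near1_dist1 z) hz.
have hs : `|s - 1| < 2^-1 := le_lt_trans (sqrt_near1_dist1 w) hw.
suff h : 1 <= `|r + s|.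
  rewrite -[z]sqrt_near1K -[w]sqrt_near1K -/r -/s subr_sqr normrM.
  by rewrite ler_peMr.
have -> : r + s = 2 - ((1 - r) + (1 - s)) by ring.
apply: le_trans (lerB_dist _ _); rewrite normr_nat lerBrDl.
have -> : 2 = 1 + (2^-1 + 2^-1) :> C by field.
rewrite addrC lerD2l (le_trans (ler_normD _ _)) //.
by rewrite lerD // distrC ltW.
Qed.

Lemma holomorphic_near_sqrt (C : numClosedFieldType) :
  holomorphic_near (@sqrt_near1 C) (1 : C).
Proof.
rewrite /holomorphic_near.
have half : \forall w \near (1 : C), `|w - 1| < 2^-1.
  have := @cvgr_distC_lt C C C (nbhs (1 : C)) _ id 1 cvg_id 2^-1.
  by apply; rewrite invr_gt0.
near=> w.
have w1 : `|w - 1| < 2^-1 by near: w.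
pose rho := @sqrt_near1 C.
have near1 : \forall z \near w, `|z - 1| < 2^-1.
  by near: w; apply: nbhs_interior half.
have rhow : rho z @[z --> w] --> rho w.
  apply: (@cvgrPdist_lt C C C (nbhs w) _ rho (rho w)).2 => e e0.
  apply: filterS2 near1
    (@cvgr_dist_lt C C C (nbhs w) _ id w cvg_id e e0) => z z1.
  apply: le_lt_trans.
  exact: sqrt_near1_lipschitz.
have rw0 : rho w != 0.
  have : w != 0.
    near: w; apply: (@cvgr_neq0 C C C (nbhs (1 : C)) _ id 1 cvg_id).
    exact: oner_neq0.
  by apply: contra_neq => rw0; rewrite -[w]sqrt_near1K -/rho rw0 expr0n.
apply/derivable1_diffP; apply/cvg_ex; exists (rho w + rho w)^-1.
have shift_w : h + w @[h --> (0 : C)^'] --> w.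
  rewrite -[X in _ --> X]add0r.
  by apply: cvgD (cvg_cst w); apply: cvg_within.
have rhow0 : rho (h + w) @[h --> (0 : C)^'] --> rho w.
  exact: (cvg_comp _ _ shift_w rhow).
(* The difference quotient at h is the inverse of rho (h + w) + rho w. *)
have : ((rho (h + w) + rho w)^-1 : C) @[h --> (0 : C)^'] --> (rho w + rho w)^-1.
  apply: cvgV; first by rewrite -mulr2n mulrn_eq0.
  exact: cvgD rhow0 (cvg_cst _).
apply: cvg_trans; apply: near_eq_cvg; near=> h => /=.
have h0 : h != 0 by near: h; apply: nbhs_dnbhs_neq.
have sum_neq0 : rho (h + w) + rho w != 0.
  near: h; apply: (cvgr_neq0 (rho w + rho w)); last first.
    by rewrite -mulr2n mulrn_eq0.
  exact: cvgD rhow0 (cvg_cst _).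
rewrite [h *: 1]mulr1 /GRing.scale /=.
apply: (mulIf sum_neq0); rewrite mulVf // -mulrA -subr_sqr !sqrt_near1K.
by rewrite addrK mulVf.
Unshelve. all: by end_near. Qed.

(** * Inverting z * (1 - z) at the origin *)

Definition logistic_inv (C : numClosedFieldType) (z : C) : C :=
  (1 - sqrt_near1 (1 - 4%:R * z)) / 2%:R.

Lemma logistic_invK (C : numClosedFieldType) (z : C) :
  logistic_inv z * (1 - logistic_inv z) = z.
Proof.
rewrite /logistic_inv; have := sqrt_near1K (1 - 4%:R * z).
move: (sqrt_near1 _) => r hr.
have -> : z = (1 - (1 - 4%:R * z)) / 4%:R by field.
by rewrite -hr; field.
Qed.

Lemma logistic_inv0 (C : numClosedFieldType) : logistic_inv (0 : C) = 0.
Proof. by rewrite /logistic_inv mulr0 subr0 sqrt_near1_1 subrr mul0r. Qed.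

Lemma holomorphic_near_logistic_inv (C : numClosedFieldType) :
  holomorphic_near (@logistic_inv C) (0 : C).
Proof.
have hid : holomorphic_near id (0 : C) by apply: filterE.
apply: holomorphic_nearM (holomorphic_near_cst _ _).
apply: holomorphic_nearD (holomorphic_near_cst _ _) (holomorphic_nearN _).
have h : holomorphic_near (fun z : C => 1 - 4%:R * z) 0.
  apply: holomorphic_nearD (holomorphic_near_cst _ _) (holomorphic_nearN _).
  exact: holomorphic_nearM (holomorphic_near_cst _ _) hid.
apply: holomorphic_near_comp h _.
by rewrite mulr0 subr0; apply: holomorphic_near_sqrt.
Qed.

Lemma near_logisticK (C : numClosedFieldType) :
  \forall s \near (0 : C), logistic_inv (s * (1 - s)) = s.
Proof.
have hid : holomorphic_near id (0 : C) by apply: filterE.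
have h : holomorphic_near (fun s : C => 1 - 2%:R * s) 0.
  apply: holomorphic_nearD (holomorphic_near_cst _ _) (holomorphic_nearN _).
  exact: holomorphic_nearM (holomorphic_near_cst _ _) hid.
have hs : \forall r \near (1 - 2%:R * 0 : C), sqrt_near1 (r ^+ 2) = r.
  by rewrite mulr0 subr0; apply: near_sqrt_near1_sqr.
apply: filterS (near_preimage h hs) => s {}hs.
rewrite /logistic_inv.
have -> : 1 - 4%:R * (s * (1 - s)) = (1 - 2%:R * s) ^+ 2 by ring.
by rewrite hs; field.
Qed.

Lemma holomorphic_near_logistic_inv_comp (C : numClosedFieldType)
    (V : normedModType C) (p : V) (f : V -> C) :
  holomorphic_near f p -> f p = 0 ->
  holomorphic_near (fun z => logistic_inv (f z)) p.
Proof.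
move=> hf f0; apply: holomorphic_near_comp hf _.
by rewrite f0; apply: holomorphic_near_logistic_inv.
Qed.

Lemma near_logisticK_comp (C : numClosedFieldType) (V : normedModType C)
    (p : V) (f : V -> C) :
  holomorphic_near f p -> f p = 0 ->
  \forall z \near p, logistic_inv (f z * (1 - f z)) = f z.
Proof.
move=> hf f0.
have h : \forall s \near f p, logistic_inv (s * (1 - s)) = s.
  by rewrite f0; apply: near_logisticK.
exact: near_preimage hf h.
Qed.

(** * Coordinate changes acting on the last two coordinates *)

Lemma eq_row_coords (C : numClosedFieldType) (N : nat) (x y : 'rV[C]_N.+1) :
    (forall i : 'I_N.+1, (i < N.-1)%N -> x 0 i = y 0 i) ->
    x_N x = x_N y -> x_N1 x = x_N1 y ->
  x = y.
Proof.
move=> xy xyN xyN1; apply/rowP => i.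
have [/xy//|Ni] := ltnP i N.-1.
have [iN|iN] := eqVneq (i : nat) N.-1.
  suff -> : i = inord N.-1 by [].
  by apply/val_inj; rewrite /= inordK // ltnS leq_pred.
suff -> : i = ord_max by [].
apply/val_inj/eqP; rewrite eqn_leq -ltnS ltn_ord /=.
by apply: leq_trans (leqSpred N) _; rewrite ltn_neqAle eq_sym iN.
Qed.

Lemma x_N_0 (C : numClosedFieldType) (N : nat) : x_N (0 : 'rV[C]_N.+1) = 0.
Proof. by rewrite /x_N mxE. Qed.

Lemma x_N1_0 (C : numClosedFieldType) (N : nat) : x_N1 (0 : 'rV[C]_N.+1) = 0.
Proof. by rewrite /x_N1 mxE. Qed.

Lemma holomorphic_near_x_N (C : numClosedFieldType) (N : nat)
    (p : 'rV[C]_N.+1) :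
  holomorphic_near (fun x => x_N x) p.
Proof. exact: holomorphic_near_coord. Qed.

Lemma holomorphic_near_x_N1 (C : numClosedFieldType) (N : nat)
    (p : 'rV[C]_N.+1) :
  holomorphic_near (fun x => x_N1 x) p.
Proof. exact: holomorphic_near_coord. Qed.

Ltac holomorphy := repeat first
  [ assumption
  | exact: holomorphic_near_cst
  | exact: holomorphic_near_x_N
  | exact: holomorphic_near_x_N1
  | apply: holomorphic_nearD
  | apply: holomorphic_nearN
  | apply: holomorphic_nearM
  | apply: holomorphic_nearX
  | apply: holomorphic_nearV ].

(** The last two coordinates are replaced by a and b, and the others are
    multiplied by c, which multiplies the sum of their squares by c ^ 2. *)
Definition warp (C : numClosedFieldType) (N : nat)
    (c a b : 'rV[C]_N.+1 -> C) (x : 'rV[C]_N.+1) : 'rV[C]_N.+1 :=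
  \row_i if (i < N.-1)%N then c x * x 0 i
         else if i == N.-1 :> nat then a x else b x.

Lemma x_N_warp (C : numClosedFieldType) (N : nat)
    (c a b : 'rV[C]_N.+1 -> C) (x : 'rV[C]_N.+1) :
  x_N (warp c a b x) = a x.
Proof.
by rewrite /x_N mxE inordK ?ltnn ?eqxx // ltnS leq_pred.
Qed.

Lemma x_N1_warp (C : numClosedFieldType) (N : nat)
    (c a b : 'rV[C]_N.+1 -> C) (x : 'rV[C]_N.+1) :
  (1 <= N)%N -> x_N1 (warp c a b x) = b x.
Proof.
case: N c a b x => // N c a b x _.
by rewrite /x_N1 mxE /= ltnNge leqnSn /= gtn_eqF.
Qed.

Lemma sum_squares_warp (C : numClosedFieldType) (N : nat)
    (c a b : 'rV[C]_N.+1 -> C) (x : 'rV[C]_N.+1) :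
  sum_squares (warp c a b x) = c x ^+ 2 * sum_squares x.
Proof.
rewrite /sum_squares mulr_sumr.
by apply: eq_bigr => i iN; rewrite mxE iN exprMn.
Qed.

Lemma warp_comp_id (C : numClosedFieldType) (N : nat)
    (c a b c' a' b' : 'rV[C]_N.+1 -> C) (x : 'rV[C]_N.+1) :
    (1 <= N)%N ->
    c' (warp c a b x) * c x = 1 -> a' (warp c a b x) = x_N x ->
    b' (warp c a b x) = x_N1 x ->
  warp c' a' b' (warp c a b x) = x.
Proof.
move=> N1 hc ha hb; apply: eq_row_coords => [i iN||].
- by rewrite !mxE iN mulrA hc mul1r.
- by rewrite x_N_warp.
- by rewrite x_N1_warp.
Qed.

Lemma warp0 (C : numClosedFieldType) (N : nat) (c a b : 'rV[C]_N.+1 -> C) :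
  a 0 = 0 -> b 0 = 0 -> warp c a b 0 = 0.
Proof.
move=> a0 b0; apply/rowP => i; rewrite !mxE mulr0 a0 b0.
by case: ifP => // _; case: ifP.
Qed.

Lemma holomorphic_near_warp (C : numClosedFieldType) (N : nat)
    (c a b : 'rV[C]_N.+1 -> C) (p : 'rV[C]_N.+1) :
    holomorphic_near c p -> holomorphic_near a p -> holomorphic_near b p ->
  holomorphic_near (warp c a b) p.
Proof.
move=> hc ha hb; apply: holomorphic_near_row => i.
under [X in holomorphic_near X]eq_fun do rewrite mxE.
case: (i < N.-1)%N; last by case: (_ == _).
exact: holomorphic_nearM hc (holomorphic_near_coord _ _).
Qed.

(** * Singular points *)

(** In the coordinates (w, b), the derivative along b reads
    3 * w * (b ^ 2 - t * w).  On w = 0 the derivative along w forces b = 0.  On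
    t * w = b ^ 2 it forces b = 0 or 3 * b = 5 * t ^ 2, while the equation
    of the curve leaves only b = 0 and b = 2 * t ^ 2. *)
Lemma plane_critical_point (C : numClosedFieldType) (t a b : C) :
    t != 0 ->
    a ^+ 3 + a * b ^+ 3 - 3%:R * t ^+ 2 * a * b ^+ 2 - 2%:R * t ^+ 3 * b ^+ 3
      + t * b ^+ 4 = 0 ->
    3%:R * a ^+ 2 + b ^+ 3 - 3%:R * t ^+ 2 * b ^+ 2 = 0 ->
    3%:R * a * b ^+ 2 - 6%:R * t ^+ 2 * a * b - 6%:R * t ^+ 3 * b ^+ 2
      + 4%:R * t * b ^+ 3 = 0 ->
  a = 0 /\ b = 0.
Proof.
move=> t0 g0 ga gb; pose w := a + t * b.
have aE : a = w - t * b by rewrite /w addrK.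
suff [w0 b0] : w = 0 /\ b = 0 by split; rewrite // aE w0 b0 mulr0 subr0.
have gw : 3%:R * w ^+ 2 - 6%:R * t * w * b + b ^+ 3 = 0.
  by rewrite -[RHS]ga aE; ring.
have gb' : 3%:R * (w * (b ^+ 2 - t * w)) = 0.
  transitivity (0 - t * 0 : C); last by ring.
  by rewrite -{1}gb -{1}ga aE; ring.
move/eqP: gb'; rewrite !mulf_eq0 pnatr_eq0 /= => /orP[/eqP w0|].
  split=> //; move: gw; rewrite w0 expr0n /= !(mulr0, mul0r) subr0 add0r.
  by move=> /eqP; rewrite expf_eq0 => /eqP.
rewrite subr_eq0 => /eqP wE.
have b3 : b ^+ 3 * (3%:R * b - 5%:R * t ^+ 2) = 0.
  transitivity (t ^+ 2 * 0 : C); last by ring.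
  rewrite -{1}gw.
  transitivity (3%:R * (t * w) ^+ 2 - 6%:R * t ^+ 2 * (t * w) * b
                + t ^+ 2 * b ^+ 3).
    by rewrite -wE; ring.
  by ring.
have b5 : b ^+ 5 * (b - 2%:R * t ^+ 2) = 0.
  transitivity (t ^+ 3 * 0 : C); last by ring.
  rewrite -{1}g0 aE.
  transitivity ((t * w) * ((t * w) ^+ 2 - 3%:R * t ^+ 2 * (t * w) * b
                           + t ^+ 2 * b ^+ 3)).
    by rewrite -wE; ring.
  by ring.
have [b0|bn0] := eqVneq b 0.
  split=> //; move/eqP: wE; rewrite b0 expr0n /= eq_sym mulf_eq0 (negPf t0).
  by move=> /eqP.
move/eqP: b3; rewrite mulf_eq0 expf_eq0 (negPf bn0) /= => /eqP b3.
move/eqP: b5; rewrite mulf_eq0 expf_eq0 (negPf bn0) /= => /eqP b5.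
suff /eqP : t ^+ 2 = 0 by rewrite expf_eq0 (negPf t0).
transitivity (0 - 3%:R * 0 : C); last by ring.
by rewrite -{1}b3 -b5; ring.
Qed.

Lemma is_derive_coord (C : numClosedFieldType) (n : nat)
    (x v : 'rV[C]_n) (i : 'I_n) :
  is_derive x v (fun y : 'rV[C]_n => y 0 i) (v 0 i).
Proof.
pose f := (fun M : 'rV[C]_n => M 0 i).
have df : differentiable f x by apply: differentiable_coord.
apply: DeriveDef; first exact: diff_derivable.
rewrite -/f deriveE //.
have lf : linear f by move=> a u w; rewrite /f !mxE.
pose lM := GRing.isLinear.Build _ _ _ _ _ lf.
pose fL : {linear _ -> _} := HB.pack f lM.
by rewrite (@diff_lin _ _ _ fL) //; apply: coord_continuous.
Qed.

Lemma is_derive_ft (C : numClosedFieldType) (N : nat) (t : C)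
    (x v : 'rV[C]_N.+1) :
  is_derive x v (ft t)
    (\sum_(i < N.+1 | (i < N.-1)%N) 2%:R * x 0 i * v 0 i
     + (3%:R * x_N x ^+ 2 + x_N1 x ^+ 3 - 3%:R * t ^+ 2 * x_N1 x ^+ 2) * x_N v
     + (3%:R * x_N x * x_N1 x ^+ 2 - 6%:R * t ^+ 2 * x_N x * x_N1 x
        - 6%:R * t ^+ 3 * x_N1 x ^+ 2 + 4%:R * t * x_N1 x ^+ 3) * x_N1 v).
Proof.
have ha : is_derive x v (@x_N C N) (x_N v) by apply: is_derive_coord.
have hb : is_derive x v (@x_N1 C N) (x_N1 v) by apply: is_derive_coord.
have hs : is_derive x v (@sum_squares C N)
    (\sum_(i < N.+1 | (i < N.-1)%N) 2%:R * x 0 i * v 0 i).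
  have -> : @sum_squares C N = \sum_(i < N.+1)
      (if (i < N.-1)%N then (fun y : 'rV[C]_N.+1 => y 0 i) ^+ 2 else cst 0).
    apply/funext => y; rewrite fct_sumE /sum_squares big_mkcond.
    by apply: eq_bigr => i _; case: ifP.
  rewrite [X in is_derive _ _ _ X]big_mkcond.
  apply: is_derive_sum => i; case: ifP => _.
    have hi := is_derive_coord x v i.
    by apply: is_derive_eq; rewrite /GRing.scale /= expr1.
  exact: is_derive_cst.
have -> : ft t = @sum_squares C N + @x_N C N ^+ 3 + @x_N C N * @x_N1 C N ^+ 3
   - (cst (3%:R * t ^+ 2) * @x_N C N * @x_N1 C N ^+ 2)
   - cst (2%:R * t ^+ 3) * @x_N1 C N ^+ 3 + cst t * @x_N1 C N ^+ 4
   :> ('rV[C]_N.+1 -> C).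
  by [].
apply: is_derive_eq.
rewrite /GRing.scale /= !fctE; ring.
Qed.

Lemma singular_point_ft (C : numClosedFieldType) (N : nat) (t : C)
    (x : 'rV[C]_N.+1) :
  (1 <= N)%N -> t != 0 -> singular_point (ft t) x <-> x = 0.
Proof.
move=> N1 t0.
have D v := @derive_val _ _ _ _ _ _ _ (is_derive_ft t x v).
have Nlt : (inord N.-1 : 'I_N.+1) != ord_max.
  by rewrite -val_eqE /= inordK ?ltnS ?leq_pred // ltn_eqF // prednK.
split=> [[fx0 dx0]|x0]; last first.
  split=> [|i].
    rewrite x0 /ft /f0 /sum_squares /x_N /x_N1 !mxE big1 => [|j _]; last first.
      by rewrite mxE expr0n.
    by ring.
  rewrite D x0 /x_N /x_N1 big1 => [|j _]; first by rewrite !mxE; ring.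
  by rewrite mxE mulr0 mul0r.
have xi (i : 'I_N.+1) : (i < N.-1)%N -> x 0 i = 0.
  move=> iN; have := dx0 i; rewrite D (bigD1 i) //= big1; last first.
    by move=> j /andP[_ ji]; rewrite mxE (negPf ji) andbF mulr0.
  rewrite /x_N /x_N1 !mxE !eqxx /=.
  have /negPf-> : inord N.-1 != i.
    by rewrite -val_eqE /= inordK ?ltnS ?leq_pred // gtn_eqF.
  have /negPf-> : ord_max != i.
    by rewrite -val_eqE /= gtn_eqF // (leq_trans iN) // leq_pred.
  rewrite !mulr0 !addr0 mulr1 => /eqP.
  by rewrite mulf_eq0 pnatr_eq0 => /eqP.
have sq0 (j : 'I_N.+1) : ~~ (j < N.-1)%N ->
    \sum_(i < N.+1 | (i < N.-1)%N)
      2%:R * x 0 i * (delta_mx 0 j : 'rV[C]_N.+1) 0 i = 0.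
  move=> jN; apply: big1 => i iN; rewrite xi //; ring.
have dN := dx0 (inord N.-1); have dN1 := dx0 ord_max.
rewrite D sq0 /x_N /x_N1 ?mxE ?eqxx in dN; last first.
  by rewrite inordK ?ltnn // ltnS leq_pred.
rewrite D sq0 /x_N /x_N1 ?mxE ?eqxx in dN1; last first.
  by rewrite /= -leqNgt leq_pred.
rewrite eq_sym (negPf Nlt) in dN.
rewrite (negPf Nlt) in dN1.
move: fx0; rewrite /ft /f0 /sum_squares big1 => [|i iN]; last first.
  by rewrite xi // expr0n.
rewrite /x_N /x_N1.
move: dN dN1; set a := x 0 _; set b := x 0 _ => dN dN1 f0.
rewrite !(andbT, andbF, mulr0, mulr1, add0r, addr0) in dN dN1 f0.
have [a0 b0] := plane_critical_point t0 f0 dN dN1.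
apply: eq_row_coords => [i iN||]; first by rewrite xi // mxE.
  by rewrite x_N_0.
by rewrite x_N1_0.
Qed.

(** * The chart adapted to the branches *)

(** The plane coordinates (sigma, s) are sent to (a, b), with a = w - t * b.
    Over each b, the branch of the node tangent to the line has parameter s and
    the transversal one has parameter 1 - s.  The line becomes sigma = 0 and the
    transversal branch sigma = s. *)
Definition branch_chart (C : numClosedFieldType) (N : nat) (t : C) :
    'rV[C]_N.+1 -> 'rV[C]_N.+1 :=
  warp (fun=> 1)
    (fun x => (3%:R * t) ^+ 3 * (x_N x * (1 - x_N x) * (1 - x_N1 x))
              - t * ((3%:R * t) ^+ 2 * (x_N1 x * (1 - x_N1 x))))
    (fun x => (3%:R * t) ^+ 2 * (x_N1 x * (1 - x_N1 x))).

Definition branch_s (C : numClosedFieldType) (N : nat) (t : C)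
    (x : 'rV[C]_N.+1) : C :=
  logistic_inv (x_N1 x / (3%:R * t) ^+ 2).

Definition branch_sigma (C : numClosedFieldType) (N : nat) (t : C)
    (x : 'rV[C]_N.+1) : C :=
  logistic_inv ((x_N x + t * x_N1 x) / (3%:R * t) ^+ 3 / (1 - branch_s t x)).

Definition branch_chart_inv (C : numClosedFieldType) (N : nat) (t : C) :
    'rV[C]_N.+1 -> 'rV[C]_N.+1 :=
  warp (fun=> 1) (branch_sigma t) (branch_s t).

Lemma branch_s0 (C : numClosedFieldType) (N : nat) (t : C) :
  branch_s t (0 : 'rV[C]_N.+1) = 0.
Proof. by rewrite /branch_s x_N1_0 mul0r logistic_inv0. Qed.

Lemma branch_sigma0 (C : numClosedFieldType) (N : nat) (t : C) :
  branch_sigma t (0 : 'rV[C]_N.+1) = 0.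
Proof.
by rewrite /branch_sigma x_N_0 x_N1_0 mulr0 addr0 !mul0r logistic_inv0.
Qed.

Lemma inverse_germs_branch_chart (C : numClosedFieldType) (N : nat) (t : C) :
  (1 <= N)%N -> t != 0 ->
  inverse_germs (@branch_chart C N t) (branch_chart_inv t) 0 0.
Proof.
move=> N1 t0.
have nt : 3%:R * t != 0 by rewrite mulf_neq0 ?pnatr_eq0.
have hF : holomorphic_near (@branch_chart C N t) 0.
  by apply: holomorphic_near_warp; holomorphy.
have hs : holomorphic_near (@branch_s C N t) 0.
  apply: holomorphic_near_logistic_inv_comp; last by rewrite x_N1_0 mul0r.
  by holomorphy; rewrite expf_neq0.
have hsg : holomorphic_near (@branch_sigma C N t) 0.
  apply: holomorphic_near_logistic_inv_comp.
    by holomorphy; rewrite ?expf_neq0 ?branch_s0 ?subr0 ?oner_neq0.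
  by rewrite x_N_0 x_N1_0 mulr0 addr0 !mul0r.
have ks : \forall x \near (0 : 'rV[C]_N.+1),
    logistic_inv (x_N1 x * (1 - x_N1 x)) = x_N1 x.
  apply: (near_logisticK_comp (holomorphic_near_x_N1 _)).
  exact: x_N1_0.
have ksg : \forall x \near (0 : 'rV[C]_N.+1),
    logistic_inv (x_N x * (1 - x_N x)) = x_N x.
  apply: (near_logisticK_comp (holomorphic_near_x_N _)).
  exact: x_N_0.
split=> //.
- by split; apply: warp0; rewrite ?branch_s0 ?branch_sigma0 ?x_N_0 ?x_N1_0;
  ring.
- by apply: holomorphic_near_warp; holomorphy.
- have : \forall x \near (0 : 'rV[C]_N.+1), 1 - x_N1 x != 0.
    by apply: near_neq0; [holomorphy|rewrite x_N1_0 subr0 oner_neq0].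
  apply: filterS3 ks ksg => x ks ksg s1.
  have sE : branch_s t (branch_chart t x) = x_N1 x.
    by rewrite /branch_s x_N1_warp // mulrC mulKf ?expf_neq0.
  apply: warp_comp_id => //; first by rewrite mul1r.
  rewrite /branch_sigma sE x_N_warp x_N1_warp // subrK.
  by rewrite mulrC [_ * _ / _]mulrC (mulKf (expf_neq0 _ nt)) mulrC mulfK.
- have : \forall x \near (0 : 'rV[C]_N.+1), 1 - branch_s t x != 0.
    by apply: near_neq0; [holomorphy|rewrite branch_s0 subr0 oner_neq0].
  apply: filterS => x s1.
  have bE : (3%:R * t) ^+ 2 * (branch_s t x * (1 - branch_s t x)) = x_N1 x.
    by rewrite logistic_invK mulrC divfK ?expf_neq0.
  apply: warp_comp_id => //; first by rewrite mul1r.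
    rewrite x_N_warp x_N1_warp // bE logistic_invK divfK //.
    rewrite mulrC divfK ?expf_neq0 //.
    by rewrite addrK.
  by rewrite x_N1_warp.
Qed.

(** * The chart to the normal form *)

(** Up to the constant tau ^ 9 / 4, the quotient of the equation in the
    coordinates (sigma, s) by the normal form in the coordinates (X, y).  It
    takes the value 1 at the origin, where it has a holomorphic square root. *)
Definition unit_ratio (C : numClosedFieldType) (sigma s : C) : C :=
  (1 - s) ^+ 3 * (1 - sigma) * (1 - sigma - s) / (1 - 2%:R * s).

Definition unit_root (C : numClosedFieldType) (k sigma s : C) : C :=
  k * sqrt_near1 (unit_ratio sigma s).

(** The plane coordinates (sigma, s) are sent to (X, y), and the other
    coordinates are divided by the square root of the unit. *)
Definition normal_chart (C : numClosedFieldType) (N : nat) (k : C) :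
    'rV[C]_N.+1 -> 'rV[C]_N.+1 :=
  warp (fun x => (unit_root k (x_N x) (x_N1 x))^-1)
    (fun x => 2%:R * 'i * (x_N x * (1 - 2%:R * x_N1 x)
                           - (x_N1 x - x_N x) ^+ 2 / 2%:R))
    (fun x => x_N1 x - x_N x).

(** The coordinate p, recovered from X = 2 * i * (p - y ^ 2 / 2). *)
Definition normal_p (C : numClosedFieldType) (N : nat) (x : 'rV[C]_N.+1) : C :=
  x_N x / (2%:R * 'i) + x_N1 x ^+ 2 / 2%:R.

(** The quadratic equation sigma * (1 - 2 * y - 2 * sigma) = p becomes
    th * (1 - th) = 2 * p / m ^ 2 with m = 1 - 2 * y and sigma = m * th / 2. *)
Definition normal_sigma (C : numClosedFieldType) (N : nat)
    (x : 'rV[C]_N.+1) : C :=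
  (1 - 2%:R * x_N1 x) / 2%:R
  * logistic_inv (2%:R * normal_p x / (1 - 2%:R * x_N1 x) ^+ 2).

Definition normal_s (C : numClosedFieldType) (N : nat) (x : 'rV[C]_N.+1) : C :=
  x_N1 x + normal_sigma x.

Definition normal_unit (C : numClosedFieldType) (N : nat) (k : C)
    (x : 'rV[C]_N.+1) : C :=
  unit_root k (normal_sigma x) (normal_s x).

Definition normal_chart_inv (C : numClosedFieldType) (N : nat) (k : C) :
    'rV[C]_N.+1 -> 'rV[C]_N.+1 :=
  warp (normal_unit k) (@normal_sigma C N) (@normal_s C N).

Lemma holomorphic_near_unit_root (C : numClosedFieldType)
    (V : normedModType C) (p : V) (k : C) (sigma s : V -> C) :
    holomorphic_near sigma p -> holomorphic_near s p ->
    sigma p = 0 -> s p = 0 ->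
  holomorphic_near (fun x => unit_root k (sigma x) (s x)) p.
Proof.
move=> hsg hs sg0 s0; apply: holomorphic_nearM (holomorphic_near_cst _ _) _.
have h : holomorphic_near (fun x => unit_ratio (sigma x) (s x)) p.
  by holomorphy; rewrite s0 mulr0 subr0 oner_neq0.
apply: holomorphic_near_comp h _.
rewrite /unit_ratio sg0 s0 !(mulr0, subr0, expr1n, mulr1) divr1.
exact: holomorphic_near_sqrt.
Qed.

Lemma unit_root0 (C : numClosedFieldType) (k : C) : unit_root k 0 0 = k.
Proof.
rewrite /unit_root /unit_ratio !(mulr0, subr0, expr1n, mulr1) divr1.
by rewrite sqrt_near1_1 mulr1.
Qed.

Lemma normal_sigma0 (C : numClosedFieldType) (N : nat) :
  normal_sigma (0 : 'rV[C]_N.+1) = 0.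
Proof.
rewrite /normal_sigma /normal_p x_N_0 x_N1_0 expr0n /= !mul0r addr0.
by rewrite mulr0 mul0r logistic_inv0 mulr0.
Qed.

Lemma normal_s0 (C : numClosedFieldType) (N : nat) :
  normal_s (0 : 'rV[C]_N.+1) = 0.
Proof. by rewrite /normal_s normal_sigma0 x_N1_0 addr0. Qed.

Lemma normal_sigmaP (C : numClosedFieldType) (N : nat) (x : 'rV[C]_N.+1) :
  1 - 2%:R * x_N1 x != 0 ->
  normal_sigma x * (1 - 2%:R * normal_s x) = normal_p x.
Proof.
move=> m0; rewrite /normal_s /normal_sigma; set m := 1 - _ in m0 *.
set z := _ / m ^+ 2.
transitivity (m ^+ 2 / 2%:R * (logistic_inv z * (1 - logistic_inv z))).
  by rewrite /m; field.
by rewrite logistic_invK /z; field.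
Qed.

Lemma holomorphic_near_normal_sigma (C : numClosedFieldType) (N : nat) :
  holomorphic_near (@normal_sigma C N) 0.
Proof.
have m0 : 1 - 2%:R * x_N1 (0 : 'rV[C]_N.+1) != 0.
  by rewrite x_N1_0 mulr0 subr0 oner_neq0.
apply: holomorphic_nearM; first by holomorphy.
apply: holomorphic_near_logistic_inv_comp.
  by holomorphy; rewrite expf_neq0.
by rewrite /normal_p x_N_0 x_N1_0 expr0n /= !mul0r addr0 mulr0 mul0r.
Qed.

Lemma holomorphic_near_normal_s (C : numClosedFieldType) (N : nat) :
  holomorphic_near (@normal_s C N) 0.
Proof.
apply: holomorphic_nearD (holomorphic_near_x_N1 _) _.
exact: holomorphic_near_normal_sigma.
Qed.

Lemma holomorphic_near_normal_unit (C : numClosedFieldType) (N : nat) (k : C) :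
  holomorphic_near (@normal_unit C N k) 0.
Proof.
apply: holomorphic_near_unit_root.
- exact: holomorphic_near_normal_sigma.
- exact: holomorphic_near_normal_s.
- exact: normal_sigma0.
- exact: normal_s0.
Qed.

Lemma normal_unit0 (C : numClosedFieldType) (N : nat) (k : C) :
  normal_unit k (0 : 'rV[C]_N.+1) = k.
Proof. by rewrite /normal_unit normal_sigma0 normal_s0 unit_root0. Qed.

Lemma near_normal_denominator (C : numClosedFieldType) (N : nat) :
  \forall x \near (0 : 'rV[C]_N.+1), 1 - 2%:R * x_N1 x != 0.
Proof.
by apply: near_neq0; [holomorphy|rewrite x_N1_0 mulr0 subr0 oner_neq0].
Qed.

Lemma inverse_germs_normal_chart (C : numClosedFieldType) (N : nat) (k : C) :
  (1 <= N)%N -> k != 0 ->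
  inverse_germs (@normal_chart_inv C N k) (normal_chart k) 0 0.
Proof.
move=> N1 k0.
have hu : holomorphic_near
    (fun x : 'rV[C]_N.+1 => unit_root k (x_N x) (x_N1 x)) 0.
  by apply: holomorphic_near_unit_root; holomorphy; rewrite ?x_N_0 ?x_N1_0.
have u0 : unit_root k (x_N (0 : 'rV[C]_N.+1)) (x_N1 (0 : 'rV[C]_N.+1)) != 0.
  by rewrite x_N_0 x_N1_0 unit_root0.
have hsg := @holomorphic_near_normal_sigma C N.
have i0 : 'i != 0 :> C := neq0Ci _.
split.
- split; apply: warp0; rewrite ?normal_sigma0 ?normal_s0 ?x_N_0 ?x_N1_0 //.
    by rewrite subr0 expr0n /= !mul0r subr0 mulr0.
  by rewrite subr0.
- apply: holomorphic_near_warp => //.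
    exact: holomorphic_near_normal_unit.
  exact: holomorphic_near_normal_s.
- by apply: holomorphic_near_warp; holomorphy.
- have nu : \forall x \near (0 : 'rV[C]_N.+1), normal_unit k x != 0.
    apply: near_neq0; first exact: holomorphic_near_normal_unit.
    by rewrite normal_unit0.
  apply: filterS2 (near_normal_denominator C N) nu => x m0 u1.
  have sE : normal_s x - normal_sigma x = x_N1 x by rewrite addrK.
  apply: warp_comp_id => //.
  + by rewrite x_N_warp x_N1_warp // mulVf.
  + rewrite x_N_warp x_N1_warp // normal_sigmaP // sE /normal_p addrK.
    by rewrite mulrC divfK // mulf_neq0 ?pnatr_eq0.
  + by rewrite x_N_warp x_N1_warp.
- have hm : holomorphic_near
      (fun x : 'rV[C]_N.+1 => 1 - 2%:R * (x_N1 x - x_N x)) 0 by holomorphy.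
  have m0 : 1 - 2%:R * (x_N1 (0 : 'rV[C]_N.+1) - x_N (0 : 'rV[C]_N.+1)) != 0.
    by rewrite x_N_0 x_N1_0 subr0 mulr0 subr0 oner_neq0.
  have kth : \forall x \near (0 : 'rV[C]_N.+1),
      let th := 2%:R * x_N x / (1 - 2%:R * (x_N1 x - x_N x)) in
      logistic_inv (th * (1 - th)) = th.
    apply: near_logisticK_comp; first by holomorphy.
    by rewrite x_N_0 mulr0 mul0r.
  apply: filterS3 kth (near_neq0 hm m0) (near_neq0 hu u0) => x kth m1 u1.
  have sgE : normal_sigma (normal_chart k x) = x_N x.
    rewrite /normal_sigma /normal_p x_N_warp x_N1_warp //.
    rewrite [X in logistic_inv X](_ : _ =
      2%:R * x_N x / (1 - 2%:R * (x_N1 x - x_N x))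
      * (1 - 2%:R * x_N x / (1 - 2%:R * (x_N1 x - x_N x)))); last first.
      by field; rewrite m1 i0.
    by rewrite kth; field.
  have sE : normal_s (normal_chart k x) = x_N1 x.
    by rewrite /normal_s sgE x_N1_warp // subrK.
  apply: warp_comp_id => //.
  by rewrite /normal_unit sgE sE mulfV.
Qed.

(** Both pairs of plane coordinates, (a, b) and (X, y), are rational functions
    of sigma and s, so that this is an identity of rational functions, up to
    i ^ 2 = - 1. *)
Lemma ft_charts (C : numClosedFieldType) (N : nat) (t k : C) (x : 'rV[C]_N.+1) :
    (1 <= N)%N -> k ^+ 2 = (3%:R * t) ^+ 9 / 4%:R ->
    1 - 2%:R * x_N1 x != 0 -> 1 - 2%:R * normal_s x != 0 ->
  ft t (branch_chart t (normal_chart_inv k x))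
    = normal_unit k x ^+ 2 * D_normal_form 6 x.
Proof.
move=> N1 hk m0 s0.
rewrite /ft /f0 /D_normal_form !sum_squares_warp !(x_N_warp, x_N1_warp) //.
move: (sum_squares x) => S.
rewrite expr1n mul1r /normal_unit /unit_root exprMn sqrt_near1K hk /unit_ratio.
have yE : x_N1 x = normal_s x - normal_sigma x by rewrite addrK.
have xE : x_N x = 2%:R * 'i * (normal_sigma x * (1 - 2%:R * normal_s x)
    - (normal_s x - normal_sigma x) ^+ 2 / 2%:R).
  rewrite normal_sigmaP // -yE /normal_p addrK mulrC divfK //.
  by rewrite mulf_neq0 ?pnatr_eq0 ?neq0Ci.
move: (normal_sigma x) (normal_s x) s0 yE xE => sg s s0 yE xE.
rewrite /= xE yE !exprMn sqrCi.
by field.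
Qed.

(** * The type of the singularity *)

Lemma ft_type_D6 (C : numClosedFieldType) (N : nat) (t : C) :
  (1 <= N)%N -> t != 0 -> singularity_of_type_D 6 (@ft C N t) 0.
Proof.
move=> N1 t0; split=> //.
  by split; [exact/singular_point_ft|apply: filterE => x /singular_point_ft ->].
(* tau ^ 9 / 4 is the constant left out of unit_ratio. *)
pose k := sqrtC ((3%:R * t) ^+ 9 / 4%:R).
have k0 : k != 0.
  by rewrite sqrtC_eq0 !(mulf_neq0, expf_neq0, invr_neq0, pnatr_eq0).
have hk : k ^+ 2 = (3%:R * t) ^+ 9 / 4%:R by rewrite sqrtCK.
exists (branch_chart t \o normal_chart_inv k), (fun x => normal_unit k x ^+ 2).
split.
  apply: inverse_germs_local_biholomorphism.
  apply: inverse_germs_comp (inverse_germs_branch_chart N1 t0).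
  exact: inverse_germs_normal_chart.
have hu := @holomorphic_near_normal_unit C N k.
have nu : \forall x \near (0 : 'rV[C]_N.+1), normal_unit k x ^+ 2 != 0.
  apply: near_neq0; first exact: holomorphic_nearX.
  by rewrite normal_unit0 expf_neq0.
have ns : \forall x \near (0 : 'rV[C]_N.+1), 1 - 2%:R * normal_s x != 0.
  have hs := @holomorphic_near_normal_s C N.
  by apply: near_neq0; [holomorphy|rewrite normal_s0 mulr0 subr0 oner_neq0].
have eqn : \forall x \near (0 : 'rV[C]_N.+1),
    ft t (branch_chart t (normal_chart_inv k x))
      = normal_unit k x ^+ 2 * D_normal_form 6 x.
  apply: filterS2 (near_normal_denominator C N) ns => x; exact: ft_charts.
by apply: filterS3 (holomorphic_nearX 2 hu) nu eqn.
Qed.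

Theorem mainTheorem10 (R : realType) (N : nat) (hN : (1 <= N)%N) :
  for_generic (fun t : R[i] =>
    (forall x : 'rV[R[i]]_N.+1, singular_point (ft t) x <-> x = 0) /\
    singularity_of_type_D 6 (@ft _ N t) 0).
Proof.
exists 'X => [|t]; first by rewrite polyX_eq0.
rewrite hornerX => t0; split; last exact: ft_type_D6.
by move=> x; apply: singular_point_ft.
Qed.
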